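(* The following statements hold. (i) For every $D\ge 3$, the set of infinite graphs with a one-way infinite bridge is neither meager nor comeager in $\mathfrak{G}^{\infty}_{\le D}$. (ii) For every $D\ge 3$, the set of infinite graphs with a two-way infinite bridge is neither meager nor comeager in $\mathfrak{G}^{\infty}_{\le D}$. (iii) For every $D\ge 4$, the set of infinite bridgeless graphs is neither meager nor comeager in $\mathfrak{G}^{\infty}_{\le D}$.
   Context: Graphs are simple. $\mathfrak{G}^{\infty}_{\le D}$ is the set of connected infinite graphs of maximum degree at most $D$, up to isomorphism. For a graph $G$ and $r\ge 0$, $B_r(G,v)$ is the subgraph induced by the vertices at distance at most $r$ from $v$, rooted at $v$, and $\mathfrak{B}_r(G)=\{B_r(G,v): v\in V(G)\}$, a set of rooted graphs up to root-preserving isomorphism (multiplicities ignored). $\mathfrak{G}^{\infty}_{\le D}$ carries the topology of the pseudometric $d(G_1,G_2)=\inf\{2^{-r}: \mathfrak{B}_r(G_1)=\mathfrak{B}_r(G_2)\}$. A subset $S$ of a space $X$ is nowhere dense in $X$ if every non-empty open $U\subseteq X$ contains a non-empty open $U'\subseteq U$ with $U'\cap S=\emptyset$; meager if it is a countable union of nowhere dense sets; comeager if its complement is meager. An edge $e$ of an infinite connected graph $G$ is a bridge if $G-e$ is disconnected. A bridge is two-way infinite if both components of $G-e$ are infinite, and one-way infinite otherwise. A graph is bridgeless if it has no bridge. *)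

(* Defs.v *)
From HB Require Import structures.
From mathcomp Require Import all_boot all_order all_algebra.
From mathcomp Require Import all_classical reals topology.

Set Implicit Arguments.
Unset Strict Implicit.
Unset Printing Implicit Defensive.

Import Order.TTheory GRing.Theory Num.Theory.
Local Open Scope classical_set_scope.
Local Open Scope card_scope.
Local Open Scope quotient_scope.
Local Open Scope ring_scope.

Record graph := Graph {
  vertex :> Type;
  adj : rel vertex;
  adj_sym : symmetric adj;
  adj_irrefl : irreflexive adj }.

Arguments adj {g}.

Definition graph_iso (G H : graph) : Prop :=
  exists f : G -> H, bijective f /\ {mono f : x y / adj x y}.

Lemma graph_iso_refl (G : graph) : graph_iso G G.
Proof. by exists id; split=> //; exists id. Qed.

Lemma graph_iso_sym (G H : graph) : graph_iso G H -> graph_iso H G.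
Proof.
move=> [f [[g fK gK] fP]]; exists g; split; first by exists f.
by move=> x y; rewrite -fP !gK.
Qed.

Lemma graph_iso_trans (G H K : graph) :
  graph_iso G H -> graph_iso H K -> graph_iso G K.
Proof.
move=> [f [fb fP]] [g [gb gP]]; exists (g \o f); split; first exact: bij_comp.
by move=> x y /=; rewrite gP fP.
Qed.

Definition connected_vertices (G : graph) (x y : G) : Prop :=
  exists p : seq G, path adj x p /\ last x p = y.

Definition connected_graph (G : graph) : Prop :=
  forall x y : G, connected_vertices x y.

Definition infinite_graph (G : graph) : Prop := infinite_set [set: G].

Definition max_degree_le (D : nat) (G : graph) : Prop :=
  forall v : G, [set w : G | adj v w] #<= `I_D.

Definition component (G : graph) (v : G) : set G :=
  [set w | connected_vertices v w].

Definition components (G : graph) : set (set G) :=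
  [set C | exists v : G, C = component v].

Section EdgeDeletion.
Variables (G : graph) (x y : G).

Definition del_adj : rel G := fun a b =>
  adj a b && ~~ `[< (a = x /\ b = y) \/ (a = y /\ b = x) >].

Lemma del_adj_sym : symmetric del_adj.
Proof.
by move=> a b; rewrite /del_adj adj_sym; congr (_ && ~~ _); apply: asbool_equiv_eq; tauto.
Qed.

Lemma del_adj_irrefl : irreflexive del_adj.
Proof. by move=> a; rewrite /del_adj adj_irrefl. Qed.

Definition del_edge : graph := Graph del_adj_sym del_adj_irrefl.

End EdgeDeletion.

Definition bridge (G : graph) (x y : G) : Prop :=
  adj x y /\ ~ connected_graph (del_edge x y).

Definition two_way_infinite_bridge (G : graph) (x y : G) : Prop :=
  bridge x y /\
  forall C : set (del_edge x y), components C -> infinite_set C.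

Definition one_way_infinite_bridge (G : graph) (x y : G) : Prop :=
  bridge x y /\ ~ two_way_infinite_bridge x y.

Definition has_two_way_infinite_bridge (G : graph) : Prop :=
  exists x y : G, two_way_infinite_bridge x y.

Definition has_one_way_infinite_bridge (G : graph) : Prop :=
  exists x y : G, one_way_infinite_bridge x y.

Definition bridgeless (G : graph) : Prop := ~ exists x y : G, bridge x y.

Record rooted_graph := RootedGraph { rgraph :> graph; root : rgraph }.

Definition rooted_iso (B C : rooted_graph) : Prop :=
  exists f : B -> C,
    [/\ bijective f, {mono f : x y / adj x y} & f (root B) = root C].

Lemma rooted_iso_refl (B : rooted_graph) : rooted_iso B B.
Proof. by exists id; split=> //; exists id. Qed.

Lemma rooted_iso_sym (B C : rooted_graph) : rooted_iso B C -> rooted_iso C B.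
Proof.
move=> [f [[g fK gK] fP f0]]; exists g; split; first by exists f.
- by move=> x y; rewrite -fP !gK.
- by rewrite -f0 fK.
Qed.

Lemma rooted_iso_trans (A B C : rooted_graph) :
  rooted_iso A B -> rooted_iso B C -> rooted_iso A C.
Proof.
move=> [f [fb fP f0]] [g [gb gP g0]]; exists (g \o f); split.
- exact: bij_comp.
- by move=> x y /=; rewrite gP fP.
- by rewrite /= f0.
Qed.

Definition dist_le (G : graph) (r : nat) (x y : G) : Prop :=
  exists p : seq G, [/\ path adj x p, last x p = y & (size p <= r)%N].

Lemma dist_le_refl (G : graph) (r : nat) (x : G) : dist_le r x x.
Proof. by exists [::]. Qed.

Section Ball.
Variables (G : graph) (r : nat) (v : G).

Definition gball_vertex : Type := {w : G | dist_le r v w}.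

Definition gball_adj : rel gball_vertex := fun a b => adj (sval a) (sval b).

Lemma gball_adj_sym : symmetric gball_adj.
Proof. by move=> a b; exact: adj_sym. Qed.

Lemma gball_adj_irrefl : irreflexive gball_adj.
Proof. by move=> a; exact: adj_irrefl. Qed.

Definition gball : rooted_graph :=
  @RootedGraph (Graph gball_adj_sym gball_adj_irrefl)
    (exist _ v (dist_le_refl r v)).

End Ball.

(* A set of rooted graphs up to root-preserving isomorphism is encoded as an
   isomorphism-closed set of rooted graphs, so that Leibniz equality of the
   encodings is equality of the sets of isomorphism types. *)
Definition gballs (r : nat) (G : graph) : set rooted_graph :=
  [set B | exists v : G, rooted_iso B (gball r v)].

Lemma gballsP (r : nat) (G H : graph) : gballs r G = gballs r H <->
  (forall v : G, exists w : H, rooted_iso (gball r v) (gball r w)) /\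
  (forall w : H, exists v : G, rooted_iso (gball r w) (gball r v)).
Proof.
split=> [GH|[GH HG]].
  split=> v.
  - have : gballs r G (gball r v) by exists v; exact: rooted_iso_refl.
    by rewrite GH.
  - have : gballs r H (gball r v) by exists v; exact: rooted_iso_refl.
    by rewrite -GH.
apply/seteqP; split=> B [v Bv].
- by have [w vw] := GH v; exists w; exact: rooted_iso_trans Bv vw.
- by have [w vw] := HG v; exists w; exact: rooted_iso_trans Bv vw.
Qed.


Lemma dist_le_iso (r s : nat) (G H : graph) (v : G) (w : H)
    (f : gball r v -> gball r w) : (s <= r)%N ->
  {mono f : x y / adj x y} -> f (root (gball r v)) = root (gball r w) ->
  forall a : gball r v, dist_le s v (sval a) -> dist_le s w (sval (f a)).
Proof.
move=> sr fP f0.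
suff main (p : seq G) : path adj v p -> (size p <= s)%N ->
    forall a : gball r v, sval a = last v p ->
    exists q : seq H, [/\ path adj w q, last w q = sval (f a) & size q = size p].
  move=> a [p [pp pl ps]]; have [q [qp ql qs]] := main p pp ps a (esym pl).
  by exists q; rewrite qs.
elim/last_ind: p => [|p x IH].
  move=> _ _ a av; exists [::]; split=> //=.
  suff -> : a = root (gball r v) by rewrite f0.
  by case: a av => a pa /= av; subst a; congr exist; exact: Prop_irrelevance.
rewrite rcons_path size_rcons => /andP[pp px] ps a.
rewrite last_rcons => ax.
have pr : dist_le r v (last v p).
  by exists p; split=> //; exact: leq_trans (ltnW ps) sr.
have [q [qp ql qs]] := IH pp (ltnW ps) (exist _ (last v p) pr) erefl.
exists (rcons q (sval (f a))); rewrite size_rcons last_rcons qs; split=> //.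
rewrite rcons_path qp ql /=.
have := fP (exist _ (last v p) pr) a.
by rewrite /= /gball_adj /= ax px => ->.
Qed.

Lemma rooted_iso_gball_le (r s : nat) (G H : graph) (v : G) (w : H) :
  (s <= r)%N -> rooted_iso (gball r v) (gball r w) ->
  rooted_iso (gball s v) (gball s w).
Proof.
move=> sr [f [[g fK gK] fP f0]].
have gP : {mono g : x y / adj x y} by move=> x y; rewrite -fP !gK.
have g0 : g (root (gball r w)) = root (gball r v) by rewrite -f0 fK.
have wd (K : graph) (u z : K) : dist_le s u z -> dist_le r u z.
  by move=> [p [? ? ps]]; exists p; split=> //; exact: leq_trans ps sr.
pose F (a : gball s v) : gball s w :=
  exist _ _ (dist_le_iso sr fP f0 (a := exist _ _ (wd _ _ _ (svalP a))) (svalP a)).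
pose F' (a : gball s w) : gball s v :=
  exist _ _ (dist_le_iso sr gP g0 (a := exist _ _ (wd _ _ _ (svalP a))) (svalP a)).
have sinj (K : graph) (u : K) (n : nat) (a b : gball n u) : sval a = sval b -> a = b.
  case: a b => [a pa] [b pb] /= ab; subst b; congr exist.
  exact: Prop_irrelevance.
exists F; split.
- exists F' => a; apply/sinj => /=.
  + by rewrite [X in g X](_ : _ = f (exist _ _ (wd _ _ _ (svalP a)))) ?fK //; exact: sinj.
  + by rewrite [X in f X](_ : _ = g (exist _ _ (wd _ _ _ (svalP a)))) ?gK //; exact: sinj.
- by move=> a b; exact: (fP (exist _ _ (wd _ _ _ (svalP a)))
    (exist _ _ (wd _ _ _ (svalP b)))).
- apply/sinj => /=; rewrite [X in f X](_ : _ = root (gball r v)) ?f0 //.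
  exact: sinj.
Qed.

Lemma gballs_le (r s : nat) (G H : graph) : (s <= r)%N ->
  gballs r G = gballs r H -> gballs s G = gballs s H.
Proof.
move=> sr /gballsP[GH HG]; apply/gballsP; split=> v.
- by have [w vw] := GH v; exists w; exact: rooted_iso_gball_le vw.
- by have [w vw] := HG v; exists w; exact: rooted_iso_gball_le vw.
Qed.

Lemma gballs0 (G H : graph) : G -> H -> gballs 0 G = gballs 0 H.
Proof.
have trivball (K L : graph) (u : K) (z : L) : rooted_iso (gball 0 u) (gball 0 z).
  have triv (M : graph) (t : M) (a : gball 0 t) : a = root (gball 0 t).
    case: a => a pa; have [p [pp pl]] := pa; rewrite leqn0 => /nilP p0.
    by subst p; rewrite /= in pl; subst a; congr exist; exact: Prop_irrelevance.
  exists (fun=> root (gball 0 z)); split=> //.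
  - exists (fun=> root (gball 0 u)) => a; first by rewrite (triv _ _ a).
    by rewrite (triv _ _ a).
  - by move=> a b; rewrite (triv _ _ a) (triv _ _ b) !adj_irrefl.
by move=> x y; apply/gballsP; split=> v; [exists y|exists x].
Qed.

Lemma gballs_iso (r : nat) (G H : graph) : graph_iso G H ->
  gballs r G = gballs r H.
Proof.
have path_iso (K L : graph) (f : K -> L) (fP : {mono f : x y / adj x y})
    (u z : K) : dist_le r u z -> dist_le r (f u) (f z).
  move=> [p [pp <- ps]]; exists (map f p); rewrite size_map last_map; split=> //.
  by rewrite path_map; apply: sub_path pp => a b /=; rewrite fP.
have ball_iso (K L : graph) : graph_iso K L ->
    forall u : K, exists z : L, rooted_iso (gball r u) (gball r z).
  move=> [f [[g fK gK] fP]] u; exists (f u).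
  have gP : {mono g : x y / adj x y} by move=> x y; rewrite -fP !gK.
  have h (a : gball r (f u)) : dist_le r u (g (sval a)).
    by have := path_iso _ _ g gP _ _ (svalP a); rewrite fK.
  have sinj (M : graph) (t : M) (a b : gball r t) : sval a = sval b -> a = b.
    case: a b => [a pa] [b pb] /= ab; subst b; congr exist.
    exact: Prop_irrelevance.
  exists (fun a : gball r u =>
    exist _ (f (sval a)) (path_iso _ _ f fP _ _ (svalP a)) : gball r (f u)); split.
  - by exists (fun a => exist _ (g (sval a)) (h a) : gball r u) => a;
      apply/sinj => /=; rewrite ?fK ?gK.
  - by move=> a b; exact: fP.
  - exact: sinj.
move=> GH; apply/gballsP; split; first exact: ball_iso.
exact/ball_iso/graph_iso_sym.
Qed.

Record inf_graph (D : nat) := InfGraph {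
  inf_graph_val :> graph;
  inf_graph_connected : connected_graph inf_graph_val;
  inf_graph_infinite : infinite_graph inf_graph_val;
  inf_graph_degree : max_degree_le D inf_graph_val }.

HB.instance Definition _ (D : nat) := gen_eqMixin (inf_graph D).
HB.instance Definition _ (D : nat) := gen_choiceMixin (inf_graph D).

Lemma inf_graph_nonempty (D : nat) (G : inf_graph D) : inhabited G.
Proof. by have [x _] := infinite_setN0 (inf_graph_infinite (i := G)). Qed.

Definition inf_graph_iso (D : nat) : rel (inf_graph D) :=
  fun G H => `[< graph_iso G H >].

Lemma inf_graph_iso_equiv (D : nat) : equiv_class_of (@inf_graph_iso D).
Proof.
split.
- by move=> G; apply/asboolP; exact: graph_iso_refl.
- by move=> G H; apply/asboolP/asboolP; exact: graph_iso_sym.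
- by move=> H G K /asboolP GH /asboolP HK; apply/asboolP; exact: graph_iso_trans GH HK.
Qed.

Canonical inf_graph_iso_equivrel (D : nat) :=
  EquivRelPack (inf_graph_iso_equiv D).

(* The parameter R is only the field of real numbers in which distances are
   measured. *)
Definition graph_space (R : realType) (D : nat) : Type :=
  {eq_quot @inf_graph_iso D}.

Section GraphSpace.
Context {R : realType} {D : nat}.
Local Notation space := (graph_space R D).

HB.instance Definition _ := Choice.on space.
HB.instance Definition _ := Quotient.on space.

Definition iso_class (G : inf_graph D) : space := \pi_space G.

Lemma iso_classP (G H : inf_graph D) :
  iso_class G = iso_class H <-> graph_iso G H.
Proof.
split=> [/(@eqmodP _ (inf_graph_iso_equivrel D))/asboolP//|GH].
by apply/(@eqmodP _ (inf_graph_iso_equivrel D))/asboolP.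
Qed.

Definition space_gballs (r : nat) (X : space) : set rooted_graph :=
  gballs r (repr X).

Lemma space_gballs_class (r : nat) (G : inf_graph D) :
  space_gballs r (iso_class G) = gballs r G.
Proof. by apply: gballs_iso; apply/iso_classP; rewrite /iso_class reprK. Qed.

Definition graph_dist (X Y : space) : R :=
  inf [set t : R | exists2 r : nat, space_gballs r X = space_gballs r Y & t = 2 ^- r].

Lemma graph_dist_lt (X Y : space) (e : R) : graph_dist X Y < e <->
  exists2 r : nat, space_gballs r X = space_gballs r Y & 2 ^- r < e.
Proof.
split=> [/inf_lt|[r XY re]].
  have [x] := inf_graph_nonempty (repr X); have [y] := inf_graph_nonempty (repr Y).
  case; first by exists (2 ^- 0); exists 0%N => //; exact: gballs0.
  by move=> _ [r XY ->] re; exists r.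
apply: le_lt_trans re; apply: ge_inf; last by exists r.
by exists 0 => _ [s _ ->]; rewrite invr_ge0 exprn_ge0.
Qed.

Definition graph_dist_ball (X : space) (e : R) : set space :=
  [set Y | graph_dist X Y < e].

Lemma graph_dist_ball_center (X : space) (e : R) : 0 < e -> graph_dist_ball X e X.
Proof.
move=> e0; apply/graph_dist_lt.
have [r re] : exists r : nat, 2 ^- r < e.
  exists (Num.bound e^-1); rewrite -[ltRHS]invrK ltf_pV2 ?posrE ?invr_gt0 ?exprn_gt0//.
  apply: lt_le_trans (archi_boundP _) _; first by rewrite invr_ge0 ltW.
  by rewrite -natrX ler_nat ltnW// ltn_expl.
by exists r.
Qed.

Lemma graph_dist_ball_sym (X Y : space) (e : R) :
  graph_dist_ball X e Y -> graph_dist_ball Y e X.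
Proof. by move=> /graph_dist_lt[r XY re]; apply/graph_dist_lt; exists r. Qed.

Lemma graph_dist_ball_triangle (X Y Z : space) (e1 e2 : R) :
  graph_dist_ball X e1 Y -> graph_dist_ball Y e2 Z -> graph_dist_ball X (e1 + e2) Z.
Proof.
move=> /graph_dist_lt[r XY re] /graph_dist_lt[s YZ se]; apply/graph_dist_lt.
have pos (n : nat) : 0 < 2 ^- n :> R by rewrite invr_gt0 exprn_gt0.
have [rs|sr] := leqP r s.
- exists r; first by rewrite XY; exact: gballs_le YZ.
  by apply: lt_trans re _; rewrite ltrDl; exact: lt_trans se.
- exists s; first by rewrite -YZ; exact: gballs_le (ltnW sr) XY.
  by apply: lt_trans se _; rewrite ltrDr; exact: lt_trans re.
Qed.

HB.instance Definition _ :=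
  hasNbhs.Build space (nbhs_ (entourage_ graph_dist_ball)).

HB.instance Definition _ := Nbhs_isPseudoMetric.Build R space
  erefl graph_dist_ball_center graph_dist_ball_sym graph_dist_ball_triangle erefl.

Lemma graph_space_openP (U : set space) : open U <->
  forall X, U X ->
    exists r : nat, forall Y, space_gballs r X = space_gballs r Y -> U Y.
Proof.
split=> [oU X UX|UP].
  have /nbhs_ballP[e /= e0 eU] : nbhs X U by apply: open_nbhs_nbhs; split.
  have /graph_dist_lt[r _ re] := graph_dist_ball_center X e0.
  by exists r => Y XY; apply: eU; apply/graph_dist_lt; exists r.
rewrite openE => X /UP[r rU]; apply/nbhs_ballP; exists (2 ^- r).
  by rewrite /= invr_gt0 exprn_gt0.
move=> Y /graph_dist_lt[s XY sr]; apply: rU; apply: gballs_le XY.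
by move: sr; rewrite ltf_pV2 ?posrE ?exprn_gt0// ltr_eXn2l ?ltr1n// => /ltnW.
Qed.

End GraphSpace.

Section Category.
Context {X : topologicalType}.

Definition nowhere_dense (S : set X) : Prop :=
  forall U : set X, open U -> U !=set0 ->
    exists U' : set X, [/\ open U', U' !=set0, U' `<=` U & U' `&` S = set0].

Definition meager (S : set X) : Prop :=
  exists F : nat -> set X, (forall n, nowhere_dense (F n)) /\ S = \bigcup_n F n.

Definition comeager (S : set X) : Prop := meager (~` S).

End Category.

(* Main.v *)
Require Import Defs.
From mathcomp Require Import all_boot all_order all_algebra.
From mathcomp Require Import all_classical reals topology.
From mathcomp Require Import zify.
Local Open Scope classical_set_scope.

Set Implicit Arguments.
Unset Strict Implicit.
Unset Printing Implicit Defensive.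

(* A meager set misses every isolated point, so it suffices to find, for each of
   the three properties, one isolated graph having it and one lacking it.  Three
   graphs do: the ray (only one-way infinite bridges), the two-way infinite path
   (only two-way infinite bridges) and the square of the ray (bridgeless, of
   maximum degree 4).  Each of them is isolated because its set of 1-balls or
   2-balls determines it: in a connected infinite graph with the same balls, a
   copy of the first few vertices can be extended greedily, one vertex at a time,
   since infinity always forces an unsaturated vertex at the boundary of the
   partial copy, and the local structure prescribes how the new vertex attaches. *)

(** * Connectivity *)

Lemma connected_vertices_refl (G : graph) (x : G) : connected_vertices x x.
Proof. by exists [::]. Qed.

Lemma connected_vertices_adj (G : graph) (x y : G) :
  adj x y -> connected_vertices x y.
Proof. by move=> xy; exists [:: y]; rewrite /= xy. Qed.

Lemma connected_vertices_trans (G : graph) (y x z : G) :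
  connected_vertices x y -> connected_vertices y z -> connected_vertices x z.
Proof.
by move=> [p [pp <-]] [q [qq <-]]; exists (p ++ q); rewrite cat_path pp last_cat.
Qed.

Lemma connected_vertices_ind (G : graph) (P : G -> Prop) (x y : G) :
  (forall a b, P a -> adj a b -> P b) -> P x -> connected_vertices x y -> P y.
Proof.
move=> Padj Px [p [pp <-]]; elim: p x Px pp => //= a p IH x Px /andP[xa ap].
exact: IH (Padj _ _ Px xa) ap.
Qed.

Lemma connected_vertices_sub (G H : graph) (f : G -> H) (x y : G) :
  (forall a b, adj a b -> connected_vertices (f a) (f b)) ->
  connected_vertices x y -> connected_vertices (f x) (f y).
Proof.
move=> fadj; apply: (connected_vertices_ind (P := fun z => connected_vertices (f x) (f z))).
  by move=> a b xa /fadj; exact: connected_vertices_trans.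
exact: connected_vertices_refl.
Qed.

Lemma connected_vertices_sym (G : graph) (x y : G) :
  connected_vertices x y -> connected_vertices y x.
Proof.
apply: (connected_vertices_ind (P := fun z => connected_vertices z x)).
  move=> a b ax ab; apply: connected_vertices_trans ax.
  by apply: connected_vertices_adj; rewrite adj_sym.
exact: connected_vertices_refl.
Qed.

(** Otherwise the finitely many [p i] would be closed under adjacency, hence all of [H] by
    connectedness. *)
Lemma connected_infinite_exit (H : graph) (p : nat -> H) (m : nat) :
  connected_graph H -> infinite_graph H -> 0 < m ->
  exists i z, [/\ i < m, adj (p i) z & forall j, j < m -> p j <> z].
Proof.
move=> Hc Hi m0; apply: contrapT => nex; apply: Hi.
have cl z : exists2 j, j < m & p j = z.
  apply: (connected_vertices_ind (P := fun z => exists2 j, j < m & p j = z)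
    (x := p 0)) (Hc (p 0) z); last by exists 0.
  move=> _ b [i im <-] ib; apply: contrapT => nb; apply: nex; exists i, b.
  by split=> // j jm pj; apply: nb; exists j.
apply: (@sub_finite_set _ _ (p @` `I_m)); last exact/finite_image/finite_II.
by move=> z _; have [j jm pj] := cl z; exists j.
Qed.

Lemma max_degree_leW (d e : nat) (G : graph) :
  d <= e -> max_degree_le d G -> max_degree_le e G.
Proof. by move=> de Gd v; apply: card_le_trans (Gd v) _; rewrite card_le_II. Qed.

(** Were [y] missed, it would be a neighbour of [x] beyond the [d] distinct ones [f i]. This turns
    the degree bound into a way of naming every neighbour of [x]. *)
Lemma max_degree_le_saturated (d : nat) (H : graph) (x y : H)
    (f : nat -> H) (s : seq nat) :
  max_degree_le d H -> adj x y -> size s = d -> uniq s -> {in s &, injective f} ->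
  (forall i, i \in s -> adj x (f i)) ->
  exists2 i, i \in s & f i = y.
Proof.
move=> Hd xy sd us finj sx; apply: contrapT => ny.
pose p i := if i < d then f (nth 0 s i) else y.
suff /card_le_trans/(_ (Hd x)) : (`I_d.+1 #<= [set w | adj x w])%card.
  by rewrite card_le_II ltnn.
have ms i : i < d -> nth 0 s i \in s by move=> id; rewrite mem_nth ?sd.
have pinj : {in `I_d.+1 &, injective p}.
  move=> i j /set_mem /= id1 /set_mem /= jd1; rewrite /p.
  case: ifPn => id; case: ifPn => jd.
  - by move/(finj _ _ (ms _ id) (ms _ jd))/eqP; rewrite nth_uniq ?sd// => /eqP.
  - by move=> e; case: ny; exists (nth 0 s i); first exact: ms.
  - by move=> e; case: ny; exists (nth 0 s j); first exact: ms.
  - by move=> _; lia.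
have pN : p @` `I_d.+1 `<=` [set w | adj x w].
  move=> _ [i _ <-] /=; rewrite /p; case: ifPn => id //.
  exact/sx/ms.
have /card_eqPle[_ +] := inj_card_eq pinj.
by move=> /card_le_trans; apply; exact: subset_card_le.
Qed.

(** * Transferring local structure along isomorphic balls *)

(** Total maps replace maps between subtypes, and every clause is restricted to the ball. The clause
    on [s] keeps track of distances to the centre, so that one can still step to a neighbour inside
    the ball. *)
Definition ball_iso (r : nat) (G H : graph) (v : G) (w : H)
    (f : G -> H) (g : H -> G) : Prop :=
  [/\ f v = w,
      forall a b, dist_le r v a -> dist_le r v b -> adj (f a) (f b) = adj a b,
      forall s a, s <= r -> dist_le s v a -> dist_le s w (f a),
      forall a, dist_le r v a -> g (f a) = a
    & forall b, dist_le r w b -> dist_le r v (g b) /\ f (g b) = b].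

Lemma rooted_iso_ball_iso (r : nat) (G H : graph) (v : G) (w : H) :
  rooted_iso (gball r v) (gball r w) -> exists f g, ball_iso r v w f g.
Proof.
move=> [h [[k hK kH] hP h0]].
(* The values [w], and [v] below, outside the balls are arbitrary. *)
pose f a := if pselect (dist_le r v a) is left p
  then sval (h (exist _ a p : gball r v)) else w.
pose g b := if pselect (dist_le r w b) is left p
  then sval (k (exist _ b p : gball r w)) else v.
have fE a (p : dist_le r v a) : f a = sval (h (exist _ a p : gball r v)).
  rewrite /f; case: pselect => [q|//].
  by rewrite (Prop_irrelevance p q).
have gE b (p : dist_le r w b) : g b = sval (k (exist _ b p : gball r w)).
  rewrite /g; case: pselect => [q|//].
  by rewrite (Prop_irrelevance p q).
have sE (K : graph) (u : K) (a : gball r u) :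
    exist _ (sval a) (svalP a) = a.
  by case: a => a p; congr exist; exact: Prop_irrelevance.
exists f, g; split.
- rewrite (fE _ (dist_le_refl r v)).
  exact: (congr1 sval h0).
- by move=> a b pa pb; rewrite (fE _ pa) (fE _ pb); exact: hP.
- move=> s a sr sa.
  have ra : dist_le r v a.
    by have [p [? ? ps]] := sa; exists p; split=> //; exact: leq_trans ps sr.
  by rewrite (fE _ ra); apply: (dist_le_iso sr hP h0).
- by move=> a pa; rewrite (fE _ pa) (gE _ (svalP _)) sE hK.
- move=> b pb; rewrite (gE _ pb); split; first exact: svalP.
  by rewrite (fE _ (svalP _)) sE kH.
Qed.

Lemma gballs_ball_iso (r : nat) (G H : graph) : gballs r G = gballs r H ->
  (forall v : G, exists (w : H) f g, ball_iso r v w f g) /\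
  (forall w : H, exists (v : G) f g, ball_iso r v w f g).
Proof.
move=> /gballsP[GH HG]; split=> [v|w].
  by have [w /rooted_iso_ball_iso] := GH v; exists w.
have [v /rooted_iso_sym/rooted_iso_ball_iso] := HG w; by exists v.
Qed.

Lemma dist_le_adj (G : graph) (r : nat) (x y : G) :
  0 < r -> adj x y -> dist_le r x y.
Proof. by move=> r0 xy; exists [:: y]; rewrite /= xy. Qed.

Lemma dist_le_rcons (G : graph) (r : nat) (x y z : G) :
  dist_le r x y -> adj y z -> dist_le r.+1 x z.
Proof.
move=> [p [pp py ps]] yz; exists (rcons p z).
by rewrite rcons_path pp py yz last_rcons size_rcons.
Qed.

Section LocalTransfer.
Variables (r : nat) (G H : graph).
Hypotheses (r0 : 0 < r) (GH : gballs r G = gballs r H).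

Lemma gballs_neighbors (w : H) : exists (v : G) (f : G -> H),
  [/\ forall a b, adj v a -> adj v b -> adj (f a) (f b) = adj a b,
      forall a, adj v a -> adj w (f a),
      forall a b, adj v a -> adj v b -> f a = f b -> a = b
    & forall z, adj w z -> exists2 a, adj v a & f a = z].
Proof.
have [_ /(_ w)[v [f [g [fv fadj fs gf fg]]]]] := gballs_ball_iso GH.
exists v, f; split.
- by move=> a b va vb; apply: fadj; exact: dist_le_adj.
- move=> a va; rewrite -fv fadj//; first exact: dist_le_refl.
  exact: dist_le_adj.
- by move=> a b /(dist_le_adj r0)/gf{2}<- /(dist_le_adj r0)/gf{2}<- ->.
- move=> z wz; have [gz fz] := fg _ (dist_le_adj r0 wz).
  exists (g z) => //; rewrite -fadj//; first by rewrite fv fz.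
  exact: dist_le_refl.
Qed.

Lemma gballs_max_degree (d : nat) : max_degree_le d G -> max_degree_le d H.
Proof.
move=> Gd w; have [v [f [_ _ _ fN]]] := gballs_neighbors w.
apply: card_le_trans (Gd v); apply: card_le_trans (card_image_le f _).
by apply: subset_card_le => z /fN[a va <-]; exists a.
Qed.

Lemma gballs_second_neighbor :
  (forall x y : G, adj x y -> exists2 z, adj x z & z <> y) ->
  forall x y : H, adj x y -> exists2 z, adj x z & z <> y.
Proof.
move=> G2 w z wz; have [v [f [_ fN finj fsurj]]] := gballs_neighbors w.
have [a va <-] := fsurj _ wz; have [b vb ba] := G2 _ _ va.
by exists (f b); [exact: fN|move=> /(finj _ _ vb va)].
Qed.

(** The link of [x] is the graph induced on its neighbours. Its connectedness is phrased by cuts,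
    which transfer along a ball isomorphism without any path. *)
Definition connected_links (K : graph) : Prop :=
  forall (x : K) (P : K -> Prop) y z, adj x y -> adj x z -> P y -> ~ P z ->
  exists a b, [/\ adj x a, adj x b, adj a b, P a & ~ P b].

Lemma gballs_connected_links : connected_links G -> connected_links H.
Proof.
move=> GL w P y z wy wz Py Pz; have [v [f [fadj fN finj fsurj]]] := gballs_neighbors w.
have [a va fa] := fsurj _ wy; have [b vb fb] := fsurj _ wz.
have [||a' [b' [va' vb' ab Pa Pb]]] := GL v (P \o f) a b va vb.
- by rewrite /= fa.
- by rewrite /= fb.
by exists (f a'), (f b'); rewrite fadj// ab; split=> //; exact: fN.
Qed.

End LocalTransfer.

(** * Greedy reconstruction of a graph from its local structure *)

(* An isomorphism of the first [n] vertices of the graph [A] on [nat] onto an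
   induced subgraph of [H]; [k] bounds the bandwidth of [A], so that all
   neighbours of the vertices [i < n - k] are already reached. *)
Definition partial_iso (A : rel nat) (k : nat) (H : graph) (n : nat)
    (f : nat -> H) : Prop :=
  [/\ forall i j, i < n -> j < n -> f i = f j -> i = j,
      forall i j, i < n -> j < n -> adj (f i) (f j) = A i j
    & forall i z, i + k < n -> adj (f i) z -> exists2 j, j < n & f j = z].

Definition extend (H : graph) (n : nat) (f : nat -> H) (z : H) : nat -> H :=
  fun i => if i < n then f i else z.

Section Reconstruction.
Variables (A : rel nat) (Asym : symmetric A) (Airr : irreflexive A).
Variable k : nat.
Hypothesis Aband : forall i j, A i j -> j <= i + k.

Local Notation G := (Graph Asym Airr).

Section PartialIso.
Variable H : graph.

Lemma partial_iso_ext (n : nat) (f g : nat -> H) :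
  (forall i, i < n -> f i = g i) -> partial_iso A k n f -> partial_iso A k n g.
Proof.
move=> fg [finj fadj fsat]; split.
- by move=> i j im jm; rewrite -!fg//; exact: finj.
- by move=> i j im jm; rewrite -!fg//; exact: fadj.
- move=> i z ik; rewrite -fg; last by lia.
  by move=> /(fsat _ _ ik)[j jn <-]; exists j => //; rewrite fg.
Qed.

(** Only the last [k] vertices need checking against [z]: earlier ones are saturated, so not
    adjacent to the new vertex [z], and the bandwidth gives the same for [A]. The one index that
    newly has to be saturated is [n - k], and the [d] neighbours listed in [s] exhaust its
    degree. *)
Lemma partial_iso_extend (d n : nat) (f : nat -> H) (z : H) (s : seq nat) :
  0 < k <= n -> max_degree_le d H ->
  partial_iso A k n f ->
  (forall i, i < n -> f i <> z) ->
  (forall i, i < n -> n <= i + k -> adj (f i) z = A i n) ->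
  size s = d -> uniq s -> {in s, forall j, j < n.+1 /\ A (n - k) j} ->
  partial_iso A k n.+1 (extend n f z).
Proof.
move=> /andP[k0 kn] Hd [finj fadj fsat] fz fzadj sd us sP.
have adjz i : i < n -> adj (f i) z = A i n.
  move=> im; have [ik|ik] := leqP n (i + k); first exact: fzadj.
  have -> : A i n = false by apply/negP => /Aband; lia.
  by apply/negP => /(fsat _ _ ik)[j /fz].
have einj i j : i < n.+1 -> j < n.+1 -> extend n f z i = extend n f z j -> i = j.
  rewrite /extend => im jm; case: ifPn => iN; case: ifPn => jN.
  - exact: finj.
  - by move=> /(fz _ iN).
  - by move=> /esym/(fz _ jN).
  - by lia.
have eadj i j : i < n.+1 -> j < n.+1 ->
    adj (extend n f z i) (extend n f z j) = A i j.
  rewrite /extend => im jm; case: ifPn => iN; case: ifPn => jN.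
  - exact: fadj.
  - by rewrite adjz//; congr A; lia.
  - by rewrite adj_sym adjz// Asym; congr A; lia.
  - by rewrite adj_irrefl (_ : i = j) ?Airr//; lia.
split=> // i y ik.
have [ik'|ik'] := ltnP (i + k) n.
  rewrite {1}/extend ifT; last by lia.
  by move=> /(fsat _ _ ik')[j jn <-]; exists j; [exact: ltnW|rewrite /extend jn].
have -> : i = n - k by lia.
move=> iy; have [||j /sP[jn _] <-] :=
  max_degree_le_saturated (f := extend n f z) Hd iy sd us.
- by move=> a b /sP[an _] /sP[bn _]; exact: einj.
- by move=> a /sP[an Aa]; rewrite eadj//; lia.
- by exists j.
Qed.

(** All but the last [k] vertices are saturated, so an edge leaving the partial copy starts among
    those [k]. *)
Lemma partial_iso_exit (n : nat) (f : nat -> H) :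
  connected_graph H -> infinite_graph H -> 0 < n -> partial_iso A k n f ->
  exists i z, [/\ i < n, n <= i + k, adj (f i) z & forall j, j < n -> f j <> z].
Proof.
move=> Hc Hi n0 [_ _ fsat].
have [i [z [im iz fz]]] := connected_infinite_exit f Hc Hi n0.
exists i, z; split=> //; rewrite leqNgt; apply/negP => ik.
by have [j /fz] := fsat _ _ ik iz.
Qed.

(** The successive extensions agree where they overlap and have a limit [h]. Saturation makes the
    image of [h] closed under adjacency, so connectedness makes [h] surjective. *)
Lemma partial_iso_limit (n : nat) (f : nat -> H) :
  connected_graph H -> 0 < n -> partial_iso A k n f ->
  (forall m (g : nat -> H), n <= m -> partial_iso A k m g ->
    exists z, partial_iso A k m.+1 (extend m g z)) ->
  graph_iso G H.
Proof.
move=> Hc n0 nf next.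
(* Choice needs a value at every pair; [f 0] is the default where there is nothing to extend. *)
have /choice[step stepP] : forall p : nat * (nat -> H), exists z,
    n <= p.1 -> @partial_iso A k H p.1 p.2 ->
    @partial_iso A k H p.1.+1 (extend p.1 p.2 z).
  move=> [m g] /=; have [nm|mn] := leqP n m; last by exists (f 0).
  have [/(next m g nm)[z gz]|ng] := pselect (@partial_iso A k H m g).
    by exists z.
  by exists (f 0).
pose F := fix F m := if m is l.+1 then extend (n + l) (F l) (step (n + l, F l)) else f.
have FP m : @partial_iso A k H (n + m) (F m).
  elim: m => [|m IH]; first by rewrite addn0.
  by rewrite addnS; apply: (stepP (n + m, F m)) => //=; exact: leq_addr.
have Fle m l i : i < n + m -> F (m + l) i = F m i.
  move=> im; elim: l => [|l IH]; first by rewrite addn0.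
  by rewrite addnS /= {1}/extend ifT //; lia.
(* The value at [i] is settled from stage [i] on, because [i < n + i]. *)
pose h i := F i i.
have hF m i : i < n + m -> F m i = h i.
  move=> im; rewrite /h; have [mi|im'] := leqP m i.
    by have := Fle m (i - m) i im; rewrite subnKC.
  have /(Fle i (m - i)) : i < n + i by lia.
  by rewrite subnKC 1?ltnW.
have hP m : @partial_iso A k H (n + m) h.
  by apply: partial_iso_ext (FP m) => i; exact: hF.
have hinj i j : h i = h j -> i = j.
  by have [+ _ _] := hP (i + j).+1; apply; lia.
have hadj i j : adj (h i) (h j) = A i j.
  by have [_ + _] := hP (i + j).+1; apply; lia.
have hsurj z : exists i, h i = z.
  apply: (connected_vertices_ind (P := fun z => exists i, h i = z)
    (x := h 0)) (Hc _ z); last by exists 0.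
  move=> _ b [i <-] ib; have [_ _ sat] := hP (i + k).+1.
  by have [||j _ <-] := sat i b; [lia|exact: ib|exists j].
have /choice[h' hK] := hsurj.
exists (h : G -> H); split; last by move=> i j; exact: hadj.
by exists h' => // i; apply: hinj.
Qed.

(** The map is the isomorphism of balls around [0]. A vertex [i] with [i + k < n] lies within
    distance [r], so its neighbours in [H] stay in the larger ball and pull back to indices at most
    [i + k]. *)
Lemma partial_iso_base (r n : nat) :
  gballs r.+1 G = gballs r.+1 H ->
  (forall i, i < n -> dist_le r.+1 (0 : G) i) ->
  (forall i, i + k < n -> dist_le r (0 : G) i) ->
  exists f : nat -> H, partial_iso A k n f.
Proof.
move=> GH d1 d0.
have [/(_ (0 : G))[w [f [g [f0 fadj fs gf fg]]]] _] := gballs_ball_iso GH.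
exists f; split.
- by move=> i j /d1/gf{2}<- /d1/gf{2}<- ->.
- by move=> i j /d1 i1 /d1 j1; exact: fadj.
- move=> i z ik iz; have i0 := d0 _ ik.
  have zr : dist_le r.+1 w z by apply: dist_le_rcons iz; exact: fs.
  have [gz fz] := fg _ zr; exists (g z); last by [].
  suff : A i (g z) by move=> /Aband; lia.
  rewrite -[A i _]/(@adj G i (g z)) -fadj ?fz//.
  by apply: d1; lia.
Qed.

End PartialIso.

End Reconstruction.

(** * Bridges *)

Section BridgeIso.
Variables (G H : graph) (f : G -> H) (g : H -> G).
Hypotheses (fK : cancel f g) (gK : cancel g f) (fP : {mono f : x y / adj x y}).

Lemma del_edge_mono (x y a b : G) :
  @adj (del_edge (f x) (f y)) (f a) (f b) = @adj (del_edge x y) a b.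
Proof.
rewrite /= /del_adj fP; congr (_ && ~~ _); apply: asbool_equiv_eq.
have finj := can_inj fK.
by split=> -[[]|[]]; [move=> /finj-> /finj->; left|move=> /finj-> /finj->; right
  |move=> -> ->; left|move=> -> ->; right].
Qed.

Lemma del_edge_connected_iso (x y a b : G) :
  @connected_vertices (del_edge (f x) (f y)) (f a) (f b) ->
  @connected_vertices (del_edge x y) a b.
Proof.
rewrite -[a in X in _ -> X]fK -[b in X in _ -> X]fK.
apply: (@connected_vertices_sub (del_edge (f x) (f y)) (del_edge x y) g).
move=> c d cd; apply: connected_vertices_adj.
by rewrite -del_edge_mono !gK.
Qed.

Lemma bridge_iso (x y : G) : bridge x y -> bridge (f x) (f y).
Proof.
move=> [xy nc]; split; first by rewrite fP.
by move=> c; apply: nc => a b; apply: del_edge_connected_iso; exact: c.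
Qed.

Lemma two_way_infinite_bridge_iso (x y : G) :
  two_way_infinite_bridge x y -> two_way_infinite_bridge (f x) (f y).
Proof.
move=> [xy inf]; split; first exact: bridge_iso.
move=> _ [v ->] fin.
apply: (inf (component (g v : del_edge x y))); first by exists (g v).
apply: (@sub_finite_set _ _ (g @` component (v : del_edge (f x) (f y)))).
  move=> w vw; exists (f w); last exact: fK.
  rewrite -[v]gK; move: vw.
  apply: (@connected_vertices_sub (del_edge x y) (del_edge (f x) (f y)) f).
  by move=> c d cd; apply: connected_vertices_adj; rewrite del_edge_mono.
exact: finite_image.
Qed.

End BridgeIso.

Lemma has_two_way_infinite_bridge_iso (G H : graph) :
  graph_iso G H -> has_two_way_infinite_bridge G -> has_two_way_infinite_bridge H.
Proof.
move=> [f [[g fK gK] fP]] [x [y xy]]; exists (f x), (f y).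
exact: two_way_infinite_bridge_iso fK gK fP _ _ xy.
Qed.

Lemma has_one_way_infinite_bridge_iso (G H : graph) :
  graph_iso G H -> has_one_way_infinite_bridge G -> has_one_way_infinite_bridge H.
Proof.
move=> [f [[g fK gK] fP]] [x [y [xy nt]]]; exists (f x), (f y).
split; first exact: bridge_iso fK gK fP _ _ xy.
have gP : {mono g : x y / adj x y} by move=> a b; rewrite -fP !gK.
by move=> /(two_way_infinite_bridge_iso gK fK gP); rewrite !fK.
Qed.

Lemma bridgeless_iso (G H : graph) :
  graph_iso G H -> bridgeless G -> bridgeless H.
Proof.
move=> /graph_iso_sym[f [[g fK gK] fP]] nG [x [y xy]]; apply: nG.
by exists (f x), (f y); exact: bridge_iso fK gK fP _ _ xy.
Qed.

(** A path that uses the deleted edge can be rerouted through the third vertex of a triangle on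
    it. *)
Lemma triangles_bridgeless (G : graph) : connected_graph G ->
  (forall x y : G, adj x y -> exists2 z, adj x z & adj z y) -> bridgeless G.
Proof.
move=> Gc tri [x [y [xy]]]; apply => a b.
apply: (@connected_vertices_sub G (del_edge x y) id) (Gc a b) => {}a {}b ab.
have irr (c d : G) : adj c d -> c <> d by move=> + cd; rewrite cd adj_irrefl.
have del (c d : G) : adj c d -> ~ ((c = x /\ d = y) \/ (c = y /\ d = x)) ->
    @connected_vertices (del_edge x y) c d.
  move=> cd ncd; apply: connected_vertices_adj.
  by rewrite /= /del_adj cd; apply/asboolPn.
have [e|] := pselect ((a = x /\ b = y) \/ (a = y /\ b = x)); last exact: del.
have [z az zb] := tri _ _ ab.
have [] := (irr _ _ az, irr _ _ zb).
by move=> az' zb'; apply: (@connected_vertices_trans (del_edge x y) z);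
  apply: del => //; case: e => -[? ?]; subst a b; case=> -[? ?]; congruence.
Qed.

(** * Isolated points *)

(** The only non-empty open subset of [[set x]] is itself, so every nowhere dense set misses [x]. *)
Lemma meager_isolated (X : topologicalType) (S : set X) (x : X) :
  open [set x] -> meager S -> ~ S x.
Proof.
move=> ox [F [Fnd ->]] [n _ Fx].
have [|U [oU [y Uy] Ux UF]] := Fnd n _ ox; first by exists x.
have yx : y = x := Ux _ Uy.
have : (U `&` F n) x by split=> //; rewrite -yx.
by rewrite UF.
Qed.

Definition isolated_graph (D : nat) (G : inf_graph D) : Prop :=
  exists r, forall H : inf_graph D, gballs r G = gballs r H -> graph_iso G H.

Section Isolated.
Variables (R : realType) (D : nat) (P : graph -> Prop).
Local Notation S := ([set iso_class G | G in [set G : inf_graph D | P G]]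
  : set (graph_space R D)).

Lemma isolated_open (G : inf_graph D) :
  isolated_graph G -> open ([set iso_class G] : set (graph_space R D)).
Proof.
move=> [r Gr]; apply/graph_space_openP => X ->; exists r => Y.
rewrite space_gballs_class => /Gr/iso_classP GY.
by rewrite /= [iso_class G]GY /iso_class reprK.
Qed.

Lemma isolated_nonmeager (G : inf_graph D) : isolated_graph G -> P G -> ~ meager S.
Proof.
by move=> /isolated_open Go PG /(meager_isolated Go); apply; exists G.
Qed.

(** [S] consists of isomorphism classes, so invariance of [P] is what places the class of [G]
    outside [S]. *)
Lemma isolated_noncomeager (G : inf_graph D) :
  (forall H K, graph_iso H K -> P H -> P K) ->
  isolated_graph G -> ~ P G -> ~ comeager S.
Proof.
move=> Piso /isolated_open Go nPG /(meager_isolated Go); apply => -[H PH].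
by move=> /iso_classP /Piso /(_ PH).
Qed.

End Isolated.

(** * Graphs on the natural numbers *)

Lemma nat_graph_connected (A : rel nat) (Asym : symmetric A) (Airr : irreflexive A) :
  (forall n, 0 < n -> exists2 m, m < n & A n m) ->
  connected_graph (Graph Asym Airr).
Proof.
move=> lower; set G := Graph _ _.
have to0 (n : nat) : @connected_vertices G n 0.
  elim/ltn_ind: n => -[_|n IH]; first exact: connected_vertices_refl.
  have [//|m mn nm] := lower n.+1.
  by apply: connected_vertices_trans (IH m mn); exact: connected_vertices_adj.
move=> x y; apply: connected_vertices_trans (to0 x) _.
exact: connected_vertices_sym (to0 y).
Qed.

(** [N i] may contain repetitions and non-neighbours, as truncated subtraction produces near [0]. *)
Lemma nat_graph_max_degree (d : nat) (A : rel nat) (Asym : symmetric A)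
    (Airr : irreflexive A) (N : nat -> seq nat) :
  (forall i, size (N i) = d) -> (forall i j, A i j -> j \in N i) ->
  max_degree_le d (Graph Asym Airr).
Proof.
move=> Nd AN i.
apply: card_le_trans (card_image_le (nth 0 (N i)) `I_d).
apply: subset_card_le => j /AN jN; exists (index j (N i)); last exact: nth_index.
by rewrite /= -(Nd i) index_mem.
Qed.

Lemma unbounded_infinite (C : set nat) (v : nat) : C v ->
  (forall m, C m -> exists2 l, m < l & C l) -> infinite_set C.
Proof.
move=> Cv up /finite_seqP[s Cs].
have big n : exists2 m, n <= m & C m.
  elim: n => [|n [m nm Cm]]; first by exists v.
  by have [l ml Cl] := up m Cm; exists l => //; exact: leq_ltn_trans ml.
have [m + Cm] := big (\max_(i <- s) i).+1.
have ms : m \in s by move: Cm; rewrite Cs.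
by rewrite ltnNge (@leq_bigmax_seq _ s xpredT id).
Qed.

(** * The ray *)

Definition ray_adj : rel nat := fun i j => (j == i.+1) || (i == j.+1).

Lemma ray_adj_sym : symmetric ray_adj.
Proof. by move=> i j; rewrite /ray_adj orbC. Qed.

Lemma ray_adj_irrefl : irreflexive ray_adj.
Proof. by move=> i; rewrite /ray_adj; lia. Qed.

Definition ray : graph := Graph ray_adj_sym ray_adj_irrefl.

Lemma ray_connected : connected_graph ray.
Proof.
apply: nat_graph_connected => n n0; exists n.-1; rewrite /ray_adj; lia.
Qed.

Lemma ray_max_degree : max_degree_le 2 ray.
Proof.
apply: (nat_graph_max_degree (N := fun i => [:: i.-1; i.+1])) => // i j.
by rewrite /ray_adj !inE; lia.
Qed.

(** The frontier is the single vertex [m.-1], so the exit vertex must attach there and to nothing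
    else. The base is the 1-ball around [0]; it saturates [0], whose degree 1 is below the bound
    2. *)
Lemma ray_isolated (H : graph) : connected_graph H -> infinite_graph H ->
  gballs 1 ray = gballs 1 H -> graph_iso ray H.
Proof.
move=> Hc Hi GH; have Hd := gballs_max_degree (isT : 0 < 1) GH ray_max_degree.
have band i j : ray_adj i j -> j <= i + 1 by rewrite /ray_adj; lia.
have [||f fP] := partial_iso_base band (n := 2) GH.
- by move=> [|[|//]] _; [exact: dist_le_refl|exact: dist_le_adj].
- by move=> [|i]; [move=> _; exact: dist_le_refl|lia].
apply: partial_iso_limit fP _ => // m g m2 gP.
have [|i [z [im ik iz gz]]] := partial_iso_exit Hc Hi _ gP; first by lia.
have im1 : i = m.-1 by lia.
exists z; apply: (partial_iso_extend ray_adj_sym ray_adj_irrefl band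
  (s := [:: m - 2; m]) _ Hd gP gz) => //; first by lia.
- move=> j jm jk; have -> : j = i by lia.
  by rewrite iz /ray_adj im1; lia.
- by rewrite /= inE; lia.
- by move=> j; rewrite !inE /ray_adj; lia.
Qed.

Lemma ray_one_way : has_one_way_infinite_bridge ray.
Proof.
exists (0 : ray), (1 : ray).
(* Deleting the first edge leaves [0] alone in its component. *)
have comp0 (w : del_edge (0 : ray) (1 : ray)) :
    @connected_vertices (del_edge (0 : ray) (1 : ray)) 0 w -> w = 0.
  apply: (@connected_vertices_ind (del_edge (0 : ray) (1 : ray)) (eq^~ 0)) => // a b -> /andP[ab /asboolPn nab].
  have b1 : b = 1 by move: ab; rewrite /= /ray_adj; lia.
  by case: nab; left.
split; first by split=> // /(_ 0 1)/comp0.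
move=> [_ inf].
apply: (inf (component (0 : del_edge (0 : ray) (1 : ray)))); first by exists 0.
by apply: (@sub_finite_set _ _ [set 0]) => // w /comp0.
Qed.

Lemma ray_no_two_way : ~ has_two_way_infinite_bridge ray.
Proof.
move=> [x [y [[xy _] inf]]].
apply: (inf (component (0 : del_edge x y))); first by exists 0.
(* The deleted edge is the only one leaving the initial segment below its larger end. *)
apply: (@sub_finite_set _ _ `I_(maxn x y)); last exact: finite_II.
move=> w; apply: (@connected_vertices_ind (del_edge x y) `I_(maxn x y)); last first.
  by move: xy; rewrite /= /ray_adj; lia.
move=> a b /= am /andP[ab /asboolPn nab]; move: xy ab; rewrite /= /ray_adj => xy ab.
rewrite ltnNge; apply/negP => bm; apply: nab.
have [?|?] : y = x.+1 \/ x = y.+1 by lia.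
- by left; split; lia.
- by right; split; lia.
Qed.

(** * The two-way infinite path *)

(* The two-way infinite path, with its vertices numbered
   ... 5, 3, 1, 0, 2, 4 ... : the truncated subtraction joins 1 to 0. *)
Definition line_adj : rel nat := fun i j =>
  ((0 < j) && (i == j - 2)) || ((0 < i) && (j == i - 2)).

Lemma line_adj_sym : symmetric line_adj.
Proof. by move=> i j; rewrite /line_adj orbC. Qed.

Lemma line_adj_irrefl : irreflexive line_adj.
Proof. by move=> i; rewrite /line_adj; lia. Qed.

Definition line : graph := Graph line_adj_sym line_adj_irrefl.

Lemma line_connected : connected_graph line.
Proof.
apply: nat_graph_connected => n n0; exists (n - 2); rewrite /line_adj; lia.
Qed.

Lemma line_max_degree : max_degree_le 2 line.
Proof.
apply: (nat_graph_max_degree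
  (N := fun i => [:: if i == 0 then 1 else i - 2; i + 2])) => // i j.
by rewrite /line_adj !inE; case: (eqVneq i 0) => ?; lia.
Qed.

(** The partial copy is a path with ends [m - 2] and [m.-1]. As [H] has no vertex of degree 1, the
    end [m - 2] has a further neighbour [z], which serves as vertex [m] once it is known not to be
    adjacent to the other end. *)
Lemma line_isolated (H : graph) : connected_graph H -> infinite_graph H ->
  gballs 1 line = gballs 1 H -> graph_iso line H.
Proof.
move=> Hc Hi GH; have Hd := gballs_max_degree (isT : 0 < 1) GH line_max_degree.
have H2 : forall x y : H, adj x y -> exists2 z, adj x z & z <> y.
  apply: (gballs_second_neighbor (isT : 0 < 1) GH) => x y.
  rewrite /= /line_adj => xy.
  have [yx|yx] := eqVneq y (x + 2).
    by exists (if x == 0 then 1 else x - 2); case: (eqVneq x 0) => ?; lia.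
  by exists (x + 2); lia.
have band i j : line_adj i j -> j <= i + 2 by rewrite /line_adj; lia.
have [||f fP] := partial_iso_base band (n := 3) GH.
- by move=> [|[|[|//]]] _; [exact: dist_le_refl|exact: dist_le_adj|exact: dist_le_adj].
- by move=> [|i]; [move=> _; exact: dist_le_refl|lia].
apply: partial_iso_limit fP _ => // m g m3 gP.
have [ginj gadj gsat] := gP.
have lower i : i < m -> 0 < i -> adj (g i) (g (i - 2)).
  by move=> im i0; rewrite gadj ?/line_adj; lia.
have [|z az zp] := H2 (g (m - 2)) (g (m - 2 - 2)); first by apply: lower; lia.
have gz j : j < m -> g j <> z.
  move=> jm gj; apply: zp; rewrite -gj; congr g.
  by move: az; rewrite -gj gadj// /line_adj; lia.
have sat2 i y : i < m -> 0 < i -> adj (g i) z -> adj (g i) y ->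
    y = g (i - 2) \/ y = z.
  move=> im i0 iz iy.
  have [|||a] := max_degree_le_saturated (f := extend m g z) (s := [:: i - 2; m])
    Hd iy erefl.
  - by rewrite /= inE; lia.
  - move=> a b; rewrite !inE /extend => /orP[]/eqP-> /orP[]/eqP->//.
    + by rewrite ltnn ifT; [move=> /gz; lia|lia].
    + by rewrite ltnn ifT; [move=> /esym/gz; lia|lia].
  - move=> a; rewrite !inE /extend => /orP[]/eqP->; last by rewrite ltnn.
    by rewrite ifT; [exact: lower|lia].
  - rewrite !inE /extend => /orP[]/eqP->; last by rewrite ltnn; right.
    by rewrite ifT; [left|lia].
(* If [z] closed the path up to a cycle, that cycle would be all of [H]. *)
have nz1 : ~ adj (g m.-1) z.
  move=> bz.
  have [|i [y [im iy ny]]] := connected_infinite_exit (extend m g z) Hc Hi (m := m.+1).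
    by lia.
  have old j : j < m -> g j <> y.
    by move=> jm; have := ny j (ltnW jm); rewrite /extend jm.
  have zy : z <> y by have := ny m (ltnSn m); rewrite /extend ltnn.
  (* No edge can leave the cycle: early indices are saturated, the two ends have their old neighbour
     and [z], and [z] has the two ends. *)
  move: iy; rewrite /extend; case: ifPn => [im'|im'] iy.
    have [ik|ik] := ltnP (i + 2) m.
      by have [j /old] := gsat _ _ ik iy.
    have iz : adj (g i) z.
      have [->//|->//] : i = m - 2 \/ i = m.-1 by lia.
    have i0 : 0 < i by lia.
    by have [/esym|/esym//] := sat2 i y im' i0 iz iy; apply: old; lia.
  have z2 : adj z (g (m - 2)) by rewrite adj_sym.
  have z1 : adj z (g m.-1) by rewrite adj_sym.
  have [|||a] := max_degree_le_saturated (f := g) (s := [:: m - 2; m.-1]) Hd iy erefl.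
  - by rewrite /= inE; lia.
  - by move=> a b; rewrite !inE => aN bN; apply: ginj; lia.
  - by move=> a; rewrite !inE => /orP[]/eqP->.
  - by rewrite !inE => aN; apply: old; lia.
exists z; apply: (partial_iso_extend line_adj_sym line_adj_irrefl band
  (s := [:: m - 2 - 2; m]) _ Hd gP gz) => //; first by lia.
- move=> j jm jk; have [->|->] : j = m - 2 \/ j = m.-1 by lia.
    by rewrite az /line_adj; lia.
  rewrite (introF idP nz1) /line_adj; lia.
- by rewrite /= inE; lia.
- by move=> j; rewrite !inE /line_adj; lia.
Qed.

Lemma line_components_infinite (x y : line) (C : set (del_edge x y)) :
  adj x y -> components C -> infinite_set C.
Proof.
move=> xy [v ->]; apply: (unbounded_infinite (v := v)).
  exact: connected_vertices_refl.
move=> m vm; pose L := del_edge x y.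
(* Comparing larger ends is enough to tell an edge from the deleted one. *)
have del (a b : line) : adj a b -> maxn a b <> maxn x y -> @connected_vertices L a b.
  move=> ab ne; apply: connected_vertices_adj; rewrite /= /del_adj ab.
  by apply/asboolPn => -[] [? ?]; subst a b; lia.
(* Normally the path continues from [m] to [m + 2] on the same side. *)
have [e|ne] := eqVneq (m + 2) (maxn x y); last first.
  exists (m + 2); first by lia.
  apply: connected_vertices_trans vm _.
  by apply: del; [rewrite /= /line_adj|]; lia.
(* The deleted edge joins [m] and [m + 2], so [m + 1] is reached through [0]. *)
have to0 (j : nat) : j < m + 2 -> @connected_vertices L j 0.
  elim/ltn_ind: j => -[_ _|j IH jm]; first exact: connected_vertices_refl.
  apply: (@connected_vertices_trans L (j.+1 - 2)); last by apply: IH; lia.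
  by apply: del; [rewrite /= /line_adj|]; lia.
exists m.+1 => //; apply: connected_vertices_trans vm _.
apply: (@connected_vertices_trans L 0); first by apply: to0; lia.
by apply: connected_vertices_sym; apply: to0; lia.
Qed.

Lemma line_no_one_way : ~ has_one_way_infinite_bridge line.
Proof.
move=> [x [y [b]]]; apply; split=> // C; apply: line_components_infinite.
by case: b.
Qed.

Lemma line_two_way : has_two_way_infinite_bridge line.
Proof.
exists (0 : line), (1 : line); split; last by move=> C; exact: line_components_infinite.
(* Without the edge between [0] and [1], every edge preserves parity. *)
split=> // /(_ 0 1) c; suff : ~~ odd 1 by [].
apply: (@connected_vertices_ind (del_edge (0 : line) (1 : line)) (fun w => ~~ odd w)) c => // a b ea /andP[ab /asboolPn nab].
move: ab; rewrite /= /line_adj => ab.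
have [ab'|ba] : (a = b - 2 /\ 0 < b) \/ (b = a - 2 /\ 0 < a) by lia.
- have [b1|b1] := eqVneq b 1; last by lia.
  by case: nab; left; split; lia.
- by lia.
Qed.

(** * The square of the ray *)

Definition strip_adj : rel nat := fun i j => [&& i != j, i <= j + 2 & j <= i + 2].

Lemma strip_adj_sym : symmetric strip_adj.
Proof. by move=> i j; rewrite /strip_adj; lia. Qed.

Lemma strip_adj_irrefl : irreflexive strip_adj.
Proof. by move=> i; rewrite /strip_adj; lia. Qed.

Definition strip : graph := Graph strip_adj_sym strip_adj_irrefl.

Lemma strip_connected : connected_graph strip.
Proof.
apply: nat_graph_connected => n n0; exists n.-1; rewrite /strip_adj; lia.
Qed.

Lemma strip_max_degree : max_degree_le 4 strip.
Proof.
apply: (nat_graph_max_degree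
  (N := fun i => [:: i - 2; i - 1; i + 1; i + 2])) => // i j.
by rewrite /strip_adj !inE; lia.
Qed.

(** The link of [x] is connected through [x.+1]: the neighbours [x - 1] and [x + 2] are adjacent to
    it, and [x - 2] reaches it by way of [x - 1]. *)
Lemma strip_connected_links : connected_links strip.
Proof.
move=> x P y z xy xz Py nPz; apply: contrapT => nab.
have step a b : adj x a -> adj x b -> adj a b -> P a -> P b.
  by move=> xa xb ab Pa; apply: contrapT => nPb; apply: nab; exists a, b.
have stepE a b : strip_adj x a -> strip_adj x b -> strip_adj a b -> P a <-> P b.
  by move=> xa xb ab; split; apply: step => //; rewrite adj_sym.
have all_next a : strip_adj x a -> P a <-> P x.+1.
  move=> xa; have [->//|ax] := eqVneq a x.+1.
  have [xa2|xa2] := boolP (strip_adj a x.+1).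
    by apply: stepE => //; rewrite /strip_adj; lia.
  have xE : x = a + 2 :> nat by move: xa xa2 ax; rewrite /strip_adj; lia.
  have xa1 : strip_adj x a.+1 by rewrite /strip_adj; lia.
  have xx1 : strip_adj x x.+1 by rewrite /strip_adj; lia.
  have aa1 : strip_adj a a.+1 by rewrite /strip_adj; lia.
  have ax1 : strip_adj a.+1 x.+1 by rewrite /strip_adj; lia.
  exact: iff_trans (stepE _ _ xa xa1 aa1) (stepE _ _ xa1 xx1 ax1).
by apply/nPz/(all_next z xz)/(all_next y xy).
Qed.

(** The frontier is [m - 2] and [m.-1], and a new vertex must attach to both. Connectedness of the
    link at the one with an exit yields a new neighbour [a] adjacent to an old one, which can only
    be the other. Radius 2 serves to saturate [0] and [1], whose degrees 2 and 3 are below the bound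
    4. *)
Lemma strip_isolated (H : graph) : connected_graph H -> infinite_graph H ->
  gballs 2 strip = gballs 2 H -> graph_iso strip H.
Proof.
move=> Hc Hi GH; have Hd := gballs_max_degree (isT : 0 < 2) GH strip_max_degree.
have Hl := gballs_connected_links (isT : 0 < 2) GH strip_connected_links.
have band i j : strip_adj i j -> j <= i + 2 by rewrite /strip_adj; lia.
have [||f fP] := partial_iso_base band (n := 5) GH.
- by move=> [|[|[|[|[|//]]]]] _; [exists [::]|exists [:: 1]|exists [:: 2]
    |exists [:: 2; 3]|exists [:: 2; 4]].
- move=> i i5; have [->|i0] := eqVneq i 0; first exact: dist_le_refl.
  by apply: dist_le_adj => //; rewrite /= /strip_adj; lia.
apply: partial_iso_limit fP _ => // m g m5 gP.
have [ginj gadj gsat] := gP.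
have [|i [y [im ik iy gy]]] := partial_iso_exit Hc Hi _ gP; first by lia.
(* [j] is the frontier index other than [i]. *)
pose j := m - 2 + m.-1 - i.
have [a [b [ia ib ab na /contrapT[l lm lb]]]] :
    exists a b, [/\ adj (g i) a, adj (g i) b, adj a b,
      ~ (exists2 l, l < m & g l = a) & ~ ~ (exists2 l, l < m & g l = b)].
  apply: (Hl _ (fun c => ~ exists2 l, l < m & g l = c) y (g j)) => //.
  - by rewrite gadj /j /strip_adj; lia.
  - by move=> [l /gy].
  - by apply; exists j => //; rewrite /j; lia.
have ga n : n < m -> g n <> a by move=> nm gn; apply: na; exists n.
(* The old vertex [g l] has a new neighbour, so [l] is on the frontier, and it differs from [i]
   because [g l] is adjacent to [g i]. *)
have ja : adj (g j) a.
  have lk : m <= l + 2.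
    rewrite leqNgt; apply/negP => lk.
    have /(gsat _ _ lk)[n /ga//] : adj (g l) a by rewrite lb adj_sym.
  have -> : j = l.
    have : i <> l by move=> il; move: ib; rewrite -lb il adj_irrefl.
    by rewrite /j; lia.
  by rewrite lb adj_sym.
exists a; apply: (partial_iso_extend strip_adj_sym strip_adj_irrefl band
  (s := [:: m - 4; m - 3; m - 1; m]) _ Hd gP ga) => //; first by lia.
- move=> n nm nk; have -> : strip_adj n m by rewrite /strip_adj; lia.
  by have [->|->] : n = i \/ n = j by rewrite /j; lia.
- by rewrite /= !inE; lia.
- by move=> n; rewrite !inE /strip_adj; lia.
Qed.

Lemma strip_bridgeless : bridgeless strip.
Proof.
apply: triangles_bridgeless strip_connected _ => x y.
rewrite /= /strip_adj => xy.
(* Consecutive vertices form a triangle with the next one, vertices two apart with the one between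
   them. *)
have [d|d] : (x + 1 = y \/ y + 1 = x) \/ (x + 2 = y \/ y + 2 = x) by lia.
- by exists (maxn x y + 1); lia.
- by exists (maxn x y - 1); lia.
Qed.

(** * Isolated points of the graph space and the three statements *)

Lemma isolated_graph_of_gballs (D d r : nat) (G : graph) : d <= D -> connected_graph G ->
  infinite_graph G -> max_degree_le d G ->
  (forall H, connected_graph H -> infinite_graph H ->
     gballs r G = gballs r H -> graph_iso G H) ->
  exists2 I : inf_graph D, inf_graph_val I = G & isolated_graph I.
Proof.
move=> dD Gc Gi /(max_degree_leW dD)Gd Guniq.
exists (InfGraph Gc Gi Gd) => //; exists r => H; apply: Guniq.
- exact: inf_graph_connected.
- exact: inf_graph_infinite.
Qed.

Theorem theorem4p17 (R : realType) :
  [/\ forall D : nat, (3 <= D)%N ->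
        let S : set (graph_space R D) :=
          [set iso_class G | G in [set G : inf_graph D | has_one_way_infinite_bridge G]] in
        ~ meager S /\ ~ comeager S,
      forall D : nat, (3 <= D)%N ->
        let S : set (graph_space R D) :=
          [set iso_class G | G in [set G : inf_graph D | has_two_way_infinite_bridge G]] in
        ~ meager S /\ ~ comeager S
    & forall D : nat, (4 <= D)%N ->
        let S : set (graph_space R D) :=
          [set iso_class G | G in [set G : inf_graph D | bridgeless G]] in
        ~ meager S /\ ~ comeager S].
Proof.
have ray_point D : 2 <= D -> exists2 I : inf_graph D, inf_graph_val I = ray & isolated_graph I.
  move=> D2.
  exact: isolated_graph_of_gballs D2 ray_connected infinite_nat ray_max_degree ray_isolated.
have line_point D : 2 <= D -> exists2 I : inf_graph D, inf_graph_val I = line & isolated_graph I.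
  move=> D2.
  exact: isolated_graph_of_gballs D2 line_connected infinite_nat line_max_degree line_isolated.
split=> D DD S.
- have [I Iray Iiso] := ray_point D (ltnW DD).
  have [J Jline Jiso] := line_point D (ltnW DD).
  split; first by apply: isolated_nonmeager Iiso _; rewrite Iray; exact: ray_one_way.
  apply: isolated_noncomeager Jiso _; first exact: has_one_way_infinite_bridge_iso.
  by rewrite Jline; exact: line_no_one_way.
- have [I Iray Iiso] := ray_point D (ltnW DD).
  have [J Jline Jiso] := line_point D (ltnW DD).
  split; first by apply: isolated_nonmeager Jiso _; rewrite Jline; exact: line_two_way.
  apply: isolated_noncomeager Iiso _; first exact: has_two_way_infinite_bridge_iso.
  by rewrite Iray; exact: ray_no_two_way.
- have [I Iray Iiso] := ray_point D (ltnW (ltnW DD)).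
  have [J Jstrip Jiso] := isolated_graph_of_gballs DD strip_connected infinite_nat
    strip_max_degree strip_isolated.
  split; first by apply: isolated_nonmeager Jiso _; rewrite Jstrip; exact: strip_bridgeless.
  apply: isolated_noncomeager Iiso _; first exact: bridgeless_iso.
  by rewrite Iray => nb; have [x [y [xy _]]] := ray_one_way; apply: nb; exists x, y.
Qed.
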